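(* Let $\gamma(t)=(u(t),t)$, $t\in[v_0,v_1]$, $v_0<v_1$, be an extremal of the resistance functional $$\mathcal{R}[u]=\int_{v_0}^{v_1}\frac{f(u)^2}{u'^2+f(u)^2}\,dv .$$ If $\gamma$ is a weak local minimum of $\mathcal{R}$, then $3u'^2>f(u)^2$ at every point of $[v_0,v_1]$.
   Context: Let $I\subset\mathbb{R}$ be an open interval and $f:I\to(0,\infty)$ a smooth function. The surface has geodesic coordinates $(u,v)$ with metric $du^2+f(u)^2dv^2$. An extremal written as a graph $u=u(v)$ is a smooth function $u:[v_0,v_1]\to I$ satisfying the Euler–Lagrange equation of $\mathcal{R}$, namely $(f(u)^2-3u'^2)(f(u)u''-f'(u)u'^2)=0$. Weak local minimum: there is $\varepsilon>0$ such that $\mathcal{R}[w]\ge\mathcal{R}[u]$ for all piecewise $C^1$ continuous functions $w:[v_0,v_1]\to I$ with the same endpoint values as $u$ and with $\sup|w-u|+\sup|w'-u'|<\varepsilon$. *)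

(* Defs.v *)
From Stdlib Require Import Reals.
From Coquelicot Require Import Coquelicot.
Open Scope R_scope.

(* [a] and [b] may be infinite. *)
Definition open_Rbar_interval (a b : Rbar) (x : R) : Prop :=
  Rbar_lt a x /\ Rbar_lt x b.

Definition smooth_on_open (D : R -> Prop) (f : R -> R) : Prop :=
  forall (n : nat) (x : R), D x -> ex_derive_n f n x.

Definition segment (a b x : R) : Prop := a <= x <= b.

(* Functions on [a, b] are represented by total functions R -> R of which only
   the values on [a, b] matter.  Accordingly all derivatives below are
   derivatives within [a, b]: two-sided at interior points, one-sided at [a]
   and [b].  Compare the definition of [is_derive], with [locally x]. *)
Definition is_derive_seg (a b : R) (g : R -> R) (x l : R) : Prop :=
  filterdiff g (within (segment a b) (locally x)) (fun h : R => scal h l).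

Definition ex_derive_seg (a b : R) (g : R -> R) (x : R) : Prop :=
  exists l : R, is_derive_seg a b g x l.

(* Unspecified where [g] has no derivative within [a, b]. *)
Definition Derive_seg (a b : R) (g : R -> R) (x : R) : R :=
  iota (is_derive_seg a b g x).

Definition Derive_n_seg (a b : R) (g : R -> R) (n : nat) : R -> R :=
  Nat.iter n (Derive_seg a b) g.

Definition smooth_seg (a b : R) (g : R -> R) : Prop :=
  forall (n : nat) (x : R),
    segment a b x -> ex_derive_seg a b (Derive_n_seg a b g n) x.

Definition C1_seg (a b : R) (g : R -> R) : Prop :=
  (forall x : R, segment a b x -> ex_derive_seg a b g x) /\
  continuous_on (segment a b) (Derive_seg a b g).

Definition piecewise_C1_seg (a b : R) (g : R -> R) : Prop :=
  continuous_on (segment a b) g /\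
  exists (n : nat) (t : nat -> R),
    t 0%nat = a /\ t n = b /\
    (forall i : nat, (i < n)%nat -> t i < t (S i)) /\
    (forall i : nat, (i < n)%nat -> C1_seg (t i) (t (S i)) g).

(* At the finitely many corners of a piecewise C^1 function [w] the integrand
   is unspecified, which does not affect the integral. *)
Definition resistance (f : R -> R) (v0 v1 : R) (w : R -> R) : R :=
  RInt (fun v : R => f (w v) ^ 2 / (Derive_seg v0 v1 w v ^ 2 + f (w v) ^ 2))
       v0 v1.

Definition extremal (I : R -> Prop) (f : R -> R) (v0 v1 : R) (u : R -> R)
  : Prop :=
  smooth_seg v0 v1 u /\
  (forall v : R, segment v0 v1 v -> I (u v)) /\
  (forall v : R, segment v0 v1 v ->
     let u' := Derive_seg v0 v1 u v in
     let u'' := Derive_n_seg v0 v1 u 2 v in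
     (f (u v) ^ 2 - 3 * u' ^ 2) * (f (u v) * u'' - Derive f (u v) * u' ^ 2)
     = 0).

Definition sup_dist (v0 v1 : R) (w u : R -> R) : Rbar :=
  Lub_Rbar (fun r : R => exists v : R,
    segment v0 v1 v /\ r = Rabs (w v - u v)).

(* The supremum of |w' - u'| over the points where both derivatives exist,
   i.e. away from the corners of [w] and [u]. *)
Definition sup_dist_deriv (v0 v1 : R) (w u : R -> R) : Rbar :=
  Lub_Rbar (fun r : R => exists v : R,
    segment v0 v1 v /\ ex_derive_seg v0 v1 w v /\ ex_derive_seg v0 v1 u v /\
    r = Rabs (Derive_seg v0 v1 w v - Derive_seg v0 v1 u v)).

Definition weak_local_minimum (I : R -> Prop) (f : R -> R) (v0 v1 : R)
    (u : R -> R) : Prop :=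
  exists eps : R, 0 < eps /\
    forall w : R -> R,
      piecewise_C1_seg v0 v1 w ->
      (forall v : R, segment v0 v1 v -> I (w v)) ->
      w v0 = u v0 -> w v1 = u v1 ->
      Rbar_lt (Rbar_plus (sup_dist v0 v1 w u) (sup_dist_deriv v0 v1 w u)) eps ->
      resistance f v0 v1 w >= resistance f v0 v1 u.

(* Main.v *)
Require Import Defs.
From Stdlib Require Import Reals Lra Lia.
From Coquelicot Require Import Coquelicot.
Open Scope R_scope.

(** Write [L(F, p) = F^2 / (p^2 + F^2)] for the integrand, with [F = f(u)] and
    [p = u'].  The idea is to test minimality with one symmetric tooth: a
    piecewise linear bump of slopes [h] and [-h] on two intervals of length [d]
    meeting at a point near [v].  The slope [h] is a fixed number, allowed by the
    weak neighbourhood, while [d] tends to 0.  The bump has height [h d], so it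
    does not move [F] in the limit, and the change of the functional divided by
    [d] tends to
      [L(F, p + h) + L(F, p - h) - 2 L(F, p)]
    at [v].  Hence along a weak local minimum this quantity is nonnegative
    ([weak_minimum_midpoint]): [L] is midpoint convex at [p] for the step [h].

    On the other hand, the quantity has the sign of [3 p^2 - F^2 - h^2]
    (the identity behind [density_midpoint_lt]).  A minimum therefore satisfies
    [3 p^2 >= F^2 + h^2 > F^2].  Working with a finite step [h] rather than with
    the second derivative of [L] in [p] is what makes the inequality strict:
    where [3 p^2 = F^2], the second derivative vanishes and the symmetric tooth
    cancels the third-order term, but the fourth-order one is negative.

    Near an endpoint [v] of the interval the tooth is centred at an interior
    point close to [v], which suffices since all quantities are continuous. *)

(** * Derivatives within a segment *)

Lemma is_derive_segE (a b : R) (g : R -> R) (x l : R) :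
  segment a b x ->
  is_derive_seg a b g x l <->
  forall eps : posreal, exists delta : posreal, forall y : R,
    segment a b y -> Rabs (y - x) < delta ->
    Rabs (g y - g x - (y - x) * l) <= eps * Rabs (y - x).
Proof.
intros xab; split.
- intros [_ dom] eps.
  assert (limx : is_filter_lim (within (segment a b) (locally x)) x).
  { intros Q HQ; unfold within; revert HQ; apply filter_imp; auto. }
  destruct (dom x limx eps) as [delta near_x].
  exists delta; intros y yab y_near; exact (near_x y y_near yab).
- intros approx; split; [exact (is_linear_scal_l (K := R_AbsRing) (V := R_NormedModule) l)|].
  intros z limz eps.
  assert (z_eq_x : z = x).
  { apply eq_close; intros e.
    assert (near_z : locally z (ball z e)) by (now exists e).
    destruct (limz _ near_z) as [delta near_x].
    exact (near_x x (ball_center x delta) xab). }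
  subst z; destruct (approx eps) as [delta near_x].
  exists delta; intros y y_near yab; exact (near_x y yab y_near).
Qed.

Lemma segment_accumulation (a b x delta : R) :
  a < b -> segment a b x -> 0 < delta ->
  exists y : R, segment a b y /\ 0 < Rabs (y - x) < delta.
Proof.
unfold segment; intros ab xab delta_pos.
destruct (Rlt_le_dec x b) as [xb|bx].
- set (r := Rmin (b - x) (delta / 2)).
  assert (r_pos : 0 < r) by (unfold r; apply Rmin_glb_lt; lra).
  assert (r <= b - x) by apply Rmin_l.
  assert (r <= delta / 2) by apply Rmin_r.
  exists (x + r); replace (x + r - x) with r by ring.
  rewrite Rabs_pos_eq; lra.
- set (r := Rmin (x - a) (delta / 2)).
  assert (r_pos : 0 < r) by (unfold r; apply Rmin_glb_lt; lra).
  assert (r <= x - a) by apply Rmin_l.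
  assert (r <= delta / 2) by apply Rmin_r.
  exists (x - r); replace (x - r - x) with (- r) by ring.
  rewrite Rabs_Ropp, Rabs_pos_eq; lra.
Qed.

(** Taking [K = 0] gives uniqueness of derivatives.  For [K > 0] it bounds
    [|w' - u'|] through the Lipschitz constant of [w - u], with no case
    distinction about the corners of [w]. *)
Lemma is_derive_seg_minus_bound (a b : R) (g1 g2 : R -> R) (x l1 l2 K : R) :
  a < b -> segment a b x ->
  is_derive_seg a b g1 x l1 -> is_derive_seg a b g2 x l2 ->
  (forall y : R, segment a b y ->
     Rabs ((g1 y - g2 y) - (g1 x - g2 x)) <= K * Rabs (y - x)) ->
  Rabs (l1 - l2) <= K.
Proof.
intros ab xab d1 d2 lip.
rewrite (is_derive_segE a b g1 x l1 xab) in d1.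
rewrite (is_derive_segE a b g2 x l2 xab) in d2.
apply le_epsilon; intros e e_pos.
assert (e2_pos : 0 < e / 2) by lra.
destruct (d1 (mkposreal _ e2_pos)) as [r1 near1].
destruct (d2 (mkposreal _ e2_pos)) as [r2 near2]; simpl in near1, near2.
destruct (segment_accumulation a b x (Rmin r1 r2) ab xab) as (y & yab & y_pos & y_near).
{ apply Rmin_glb_lt; apply cond_pos. }
assert (Rmin r1 r2 <= r1) by apply Rmin_l.
assert (Rmin r1 r2 <= r2) by apply Rmin_r.
specialize (near1 y yab ltac:(lra)); specialize (near2 y yab ltac:(lra)).
specialize (lip y yab).
apply (Rmult_le_reg_r (Rabs (y - x))); [exact y_pos|].
rewrite <- Rabs_mult.
set (A := g1 y - g1 x - (y - x) * l1) in *.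
set (B := g2 y - g2 x - (y - x) * l2) in *.
set (C := g1 y - g2 y - (g1 x - g2 x)) in *.
replace ((l1 - l2) * (y - x)) with (C + (B - A)) by (unfold A, B, C; ring).
assert (t1 := Rabs_triang C (B - A)).
assert (t2 := Rabs_triang B (- A)); rewrite Rabs_Ropp in t2.
replace (B + - A) with (B - A) in t2 by ring.
lra.
Qed.

Lemma Derive_seg_eq (a b : R) (g : R -> R) (x l : R) :
  a < b -> segment a b x -> is_derive_seg a b g x l -> Derive_seg a b g x = l.
Proof.
intros ab xab d.
apply (iota_unique (V := R_CompleteNormedModule)); [|exact d].
intros l' d'; apply Rminus_diag_uniq.
assert (bound : Rabs (l' - l) <= 0).
{ apply (is_derive_seg_minus_bound a b g g x l' l 0 ab xab d' d).
  intros y _; replace (g y - g y - (g x - g x)) with 0 by ring.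
  rewrite Rabs_R0; lra. }
assert (nn := Rabs_pos (l' - l)).
destruct (Req_dec (l' - l) 0) as [e|ne]; [exact e|].
apply Rabs_pos_lt in ne; lra.
Qed.

Lemma is_derive_Derive_seg (a b : R) (g : R -> R) (x : R) :
  a < b -> segment a b x -> ex_derive_seg a b g x ->
  is_derive_seg a b g x (Derive_seg a b g x).
Proof.
intros ab xab [l d]; rewrite (Derive_seg_eq a b g x l ab xab d); exact d.
Qed.

(** The form in which competitors are differentiated: on each of its pieces,
    a competitor is [u] plus an affine function of slope [s]. *)
Lemma is_derive_seg_plus_affine (v0 v1 a b : R) (u w : R -> R) (x l s : R) :
  v0 <= a -> b <= v1 -> segment a b x ->
  is_derive_seg v0 v1 u x l ->
  (forall y : R, segment a b y -> w y - w x = u y - u x + s * (y - x)) ->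
  is_derive_seg a b w x (l + s).
Proof.
intros v0a bv1 xab d incr.
assert (sub : forall y, segment a b y -> segment v0 v1 y)
  by (unfold segment; intros; lra).
rewrite (is_derive_segE v0 v1 u x l (sub x xab)) in d.
apply is_derive_segE; [exact xab|]; intros eps.
destruct (d eps) as [delta near_x]; exists delta; intros y yab y_near.
rewrite (incr y yab).
replace (u y - u x + s * (y - x) - (y - x) * (l + s))
  with (u y - u x - (y - x) * l) by ring.
exact (near_x y (sub y yab) y_near).
Qed.

(** Derivatives of competitors are computed piece by piece, but the functional
    uses derivatives within the whole interval; inside a piece they agree. *)
Lemma is_derive_seg_interior (v0 v1 a b : R) (g : R -> R) (x l : R) :
  v0 <= a -> b <= v1 -> a < x < b ->
  is_derive_seg a b g x l -> is_derive_seg v0 v1 g x l.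
Proof.
intros v0a bv1 xab d.
assert (xs : segment a b x) by (unfold segment; lra).
rewrite (is_derive_segE a b g x l xs) in d.
apply is_derive_segE; [unfold segment; lra|]; intros eps.
destruct (d eps) as [delta near_x].
assert (r_pos : 0 < Rmin delta (Rmin (x - a) (b - x))).
{ repeat apply Rmin_glb_lt; try lra; apply cond_pos. }
exists (mkposreal _ r_pos); simpl; intros y _ y_near.
apply Rmin_Rgt_l in y_near; destruct y_near as [y1 y2].
apply Rmin_Rgt_l in y2; destruct y2 as [y2 y3].
apply Rabs_def2 in y2; apply Rabs_def2 in y3.
apply near_x; [unfold segment; lra|exact y1].
Qed.

Lemma is_derive_seg_continuous (a b : R) (g : R -> R) (x l : R) :
  segment a b x -> is_derive_seg a b g x l ->
  filterlim g (within (segment a b) (locally x)) (locally (g x)).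
Proof.
intros xab d; rewrite (is_derive_segE a b g x l xab) in d.
apply filterlim_locally; intros eps.
destruct (d (mkposreal 1 Rlt_0_1)) as [delta near_x]; simpl in near_x.
assert (K_pos : 0 < 1 + Rabs l) by (assert (h := Rabs_pos l); lra).
assert (r_pos : 0 < Rmin delta (eps / (1 + Rabs l))).
{ apply Rmin_glb_lt; [apply cond_pos|].
  apply Rdiv_lt_0_compat; [apply cond_pos|exact K_pos]. }
exists (mkposreal _ r_pos); intros y y_near yab.
change (Rabs (y - x) < Rmin delta (eps / (1 + Rabs l))) in y_near.
change (Rabs (g y - g x) < eps).
apply Rmin_Rgt_l in y_near; destruct y_near as [y1 y2].
specialize (near_x y yab y1).
apply (Rmult_lt_compat_r (1 + Rabs l)) in y2; [|exact K_pos].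
replace (eps / (1 + Rabs l) * (1 + Rabs l)) with (pos eps) in y2 by (field; lra).
assert (t := Rabs_triang (g y - g x - (y - x) * l) ((y - x) * l)).
replace (g y - g x - (y - x) * l + (y - x) * l) with (g y - g x) in t by ring.
rewrite Rabs_mult in t; lra.
Qed.

(** * Continuous extension from a segment *)

(** Composing with the projection onto [[a, b]] turns functions that are only
    continuous within [[a, b]] into continuous functions on the line, so that
    the integrability criterion for continuous functions applies. *)
Definition clamp (a b v : R) : R := Rmax a (Rmin v b).

Lemma clamp_segment (a b v : R) : a <= b -> segment a b (clamp a b v).
Proof.
intros ab; unfold segment, clamp; split; [apply Rmax_l|].
apply Rmax_lub; [exact ab|apply Rmin_r].
Qed.

Lemma clamp_id (a b v : R) : segment a b v -> clamp a b v = v.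
Proof.
intros [av vb]; unfold clamp; rewrite Rmin_left, Rmax_right; auto.
Qed.

Lemma clamp_lipschitz (a b x y : R) :
  Rabs (clamp a b y - clamp a b x) <= Rabs (y - x).
Proof.
unfold clamp, Rmax, Rmin, Rabs; repeat destruct Rle_dec; repeat destruct Rcase_abs; lra.
Qed.

Lemma continuous_clamp_comp (a b : R) (g : R -> R) (x : R) :
  a <= b -> continuous_on (segment a b) g ->
  continuous (fun v : R => g (clamp a b v)) x.
Proof.
intros ab cont.
apply (filterlim_comp _ _ _ (clamp a b) g _
         (within (segment a b) (locally (clamp a b x)))).
- intros Q [delta near]; exists delta; intros y y_near.
  apply near; [|apply clamp_segment; exact ab].
  change (Rabs (clamp a b y - clamp a b x) < delta).
  apply Rle_lt_trans with (2 := y_near), clamp_lipschitz.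
- apply cont, clamp_segment, ab.
Qed.

(** * The tooth and its effect on an integral *)

Definition tooth (m d v : R) : R := Rmax 0 (d - Rabs (v - m)).

Lemma tooth_lipschitz (m d x y : R) :
  Rabs (tooth m d y - tooth m d x) <= Rabs (y - x).
Proof.
unfold tooth, Rmax, Rabs; repeat destruct Rle_dec; repeat destruct Rcase_abs; lra.
Qed.

Lemma tooth_bounds (m d v : R) : 0 <= d -> 0 <= tooth m d v <= d.
Proof.
unfold tooth, Rmax, Rabs; intros; repeat destruct Rle_dec; repeat destruct Rcase_abs; lra.
Qed.

Lemma tooth_outside (m d v : R) : d <= Rabs (v - m) -> tooth m d v = 0.
Proof. unfold tooth, Rmax; intros; destruct Rle_dec; lra. Qed.

Lemma tooth_left (m d v : R) : m - d <= v <= m -> tooth m d v = v - (m - d).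
Proof.
intros; unfold tooth, Rmax, Rabs; repeat destruct Rle_dec; repeat destruct Rcase_abs; lra.
Qed.

Lemma tooth_right (m d v : R) : m <= v <= m + d -> tooth m d v = m + d - v.
Proof.
intros; unfold tooth, Rmax, Rabs; repeat destruct Rle_dec; repeat destruct Rcase_abs; lra.
Qed.

Lemma tooth_continuous (m d x : R) : continuous (tooth m d) x.
Proof.
apply filterlim_locally; intros eps; exists eps; intros y y_near.
change (Rabs (tooth m d y - tooth m d x) < eps).
apply Rle_lt_trans with (2 := y_near), tooth_lipschitz.
Qed.

(** The average comparison behind the whole argument: only the two halves of the
    tooth, of equal length [d], contribute to [RInt W - RInt G0], which is at
    most [d * (alpha + beta - 2 * gamma)].  The values of [W] at the corners are
    arbitrary. *)
Lemma RInt_tooth_lt (G0 Gl Gr W : R -> R) (v0 v1 m d alpha beta gamma : R) :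
  (forall v, continuous G0 v) -> (forall v, continuous Gl v) ->
  (forall v, continuous Gr v) ->
  0 < d -> v0 < m - d -> m + d < v1 ->
  (forall v, v0 < v < m - d \/ m + d < v < v1 -> W v = G0 v) ->
  (forall v, m - d < v < m -> W v = Gl v) ->
  (forall v, m < v < m + d -> W v = Gr v) ->
  (forall v, m - d < v < m -> Gl v <= alpha) ->
  (forall v, m < v < m + d -> Gr v <= beta) ->
  (forall v, m - d < v < m + d -> gamma <= G0 v) ->
  alpha + beta < 2 * gamma ->
  RInt W v0 v1 < RInt G0 v0 v1.
Proof.
intros c0 cl cr d_pos v0m mv1 Wout Wl Wr bl br b0 lt.
assert (ex : forall G : R -> R, (forall v, continuous G v) ->
          forall x y, ex_RInt G x y).
{ intros G cG x y; apply (ex_RInt_continuous (V := R_CompleteNormedModule)).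
  intros z _; apply cG. }
assert (piece : forall (G : R -> R) (x y : R), (forall v, continuous G v) ->
          x < y -> (forall v, x < v < y -> W v = G v) ->
          ex_RInt W x y /\ RInt W x y = RInt G x y).
{ intros G x y cG xy eqG.
  assert (eqG' : forall v, Rmin x y < v < Rmax x y -> W v = G v).
  { intros v; rewrite Rmin_left, Rmax_right by lra; apply eqG. }
  split; [|apply RInt_ext; exact eqG'].
  apply (ex_RInt_ext (V := R_NormedModule) G W); [|apply ex; exact cG].
  intros v hv; symmetry; apply eqG', hv. }
destruct (piece G0 v0 (m - d) c0 ltac:(lra) ltac:(intros; apply Wout; lra)) as [e1 E1].
destruct (piece Gl (m - d) m cl ltac:(lra) Wl) as [e2 E2].
destruct (piece Gr m (m + d) cr ltac:(lra) Wr) as [e3 E3].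
destruct (piece G0 (m + d) v1 c0 ltac:(lra) ltac:(intros; apply Wout; lra)) as [e4 E4].
assert (e12 := ex_RInt_Chasles W v0 (m - d) m e1 e2).
assert (e123 := ex_RInt_Chasles W v0 m (m + d) e12 e3).
assert (S1 := RInt_Chasles W v0 (m - d) m e1 e2).
assert (S2 := RInt_Chasles W v0 m (m + d) e12 e3).
assert (S3 := RInt_Chasles W v0 (m + d) v1 e123 e4).
assert (T1 := RInt_Chasles G0 v0 (m - d) (m + d) (ex _ c0 _ _) (ex _ c0 _ _)).
assert (T2 := RInt_Chasles G0 v0 (m + d) v1 (ex _ c0 _ _) (ex _ c0 _ _)).
assert (const : forall c x y : R, RInt (fun _ => c) x y = (y - x) * c)
  by (intros; rewrite (RInt_const (V := R_CompleteNormedModule)); reflexivity).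
assert (Il : RInt Gl (m - d) m <= d * alpha).
{ replace (d * alpha) with ((m - (m - d)) * alpha) by ring; rewrite <- const.
  apply RInt_le; auto; [lra|apply ex_RInt_const]. }
assert (Ir : RInt Gr m (m + d) <= d * beta).
{ replace (d * beta) with ((m + d - m) * beta) by ring; rewrite <- const.
  apply RInt_le; auto; [lra|apply ex_RInt_const]. }
assert (I0 : d * (2 * gamma) <= RInt G0 (m - d) (m + d)).
{ replace (d * (2 * gamma)) with ((m + d - (m - d)) * gamma) by ring.
  rewrite <- const.
  apply RInt_le; auto; [lra|apply ex_RInt_const]. }
change plus with Rplus in *; simpl in *.
apply (Rmult_lt_compat_l d) in lt; [|exact d_pos].
rewrite <- T2, <- T1, <- S3, <- S2, <- S1, E1, E2, E3, E4. lra.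
Qed.

Lemma C1_seg_of_derivative (a b : R) (g Q : R -> R) :
  a < b -> (forall x, continuous Q x) ->
  (forall x, segment a b x -> is_derive_seg a b g x (Q x)) ->
  C1_seg a b g.
Proof.
intros ab cQ d; split; [intros x xab; exists (Q x); auto|].
apply (continuous_on_ext (segment a b) Q).
- intros y yab; symmetry; apply Derive_seg_eq; auto.
- apply continuous_on_forall; auto.
Qed.

(** * The integrand *)

Definition density (F p : R) : R := F ^ 2 / (p ^ 2 + F ^ 2).

(** Reducing to a common denominator, [2 L(p) - L(p + h) - L(p - h)] equals
    [2 F^2 h^2 (F^2 - 3 p^2 + h^2)] over a product of positive factors. *)
Lemma density_midpoint_lt (F p h : R) :
  0 < F -> 0 < h -> 3 * p ^ 2 <= F ^ 2 ->
  density F (p + h) + density F (p - h) < 2 * density F p.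
Proof.
intros F_pos h_pos small; unfold density.
assert (pos : forall q, 0 < q ^ 2 + F ^ 2) by (intros q; nra).
assert (D0 := pos p); assert (Dp := pos (p + h)); assert (Dm := pos (p - h)).
apply Rlt_0_minus.
replace (2 * (F ^ 2 / (p ^ 2 + F ^ 2)) -
    (F ^ 2 / ((p + h) ^ 2 + F ^ 2) + F ^ 2 / ((p - h) ^ 2 + F ^ 2)))
  with (2 * F ^ 2 * h ^ 2 * (F ^ 2 - 3 * p ^ 2 + h ^ 2) /
    ((p ^ 2 + F ^ 2) * ((p + h) ^ 2 + F ^ 2) * ((p - h) ^ 2 + F ^ 2)))
  by (field; repeat split; apply Rgt_not_eq; assumption).
apply Rdiv_lt_0_compat; repeat apply Rmult_lt_0_compat; nra.
Qed.

Lemma continuous_density (T : UniformSpace) (F P : T -> R) (t : T) :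
  continuous F t -> continuous P t -> 0 < F t ->
  continuous (fun s => density (F s) (P s)) t.
Proof.
intros cF cP F_pos.
assert (sq : forall G : T -> R, continuous G t -> continuous (fun s => G s ^ 2) t).
{ intros G cG.
  apply (continuous_ext (fun s => mult (G s) (G s))).
  - intros s; change (G s * G s = G s ^ 2); ring.
  - apply (continuous_mult (K := R_AbsRing)); exact cG. }
apply (continuous_mult (K := R_AbsRing) (fun s => F s ^ 2)
         (fun s => / (P s ^ 2 + F s ^ 2))); [apply sq, cF|].
apply (continuous_comp (fun s => P s ^ 2 + F s ^ 2) Rinv).
- apply (continuous_plus (V := R_NormedModule) (fun s => P s ^ 2) (fun s => F s ^ 2));
    apply sq; assumption.
- apply continuous_Rinv; nra.
Qed.

(** * Minimality forces midpoint convexity *)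

Lemma small_centred_interval (v0 v1 v rho : R) :
  v0 < v1 -> segment v0 v1 v -> 0 < rho ->
  exists m d : R, 0 < d < rho /\ v0 < m - d /\ m + d < v1 /\
    forall y, m - d < y < m + d -> Rabs (y - v) < rho.
Proof.
intros lt [v0v vv1] rho_pos.
set (r := Rmin (rho / 2) ((v1 - v0) / 4)).
assert (r_pos : 0 < r) by (unfold r; apply Rmin_glb_lt; lra).
assert (r1 : r <= rho / 2) by apply Rmin_l.
assert (r2 : r <= (v1 - v0) / 4) by apply Rmin_r.
destruct (Rle_lt_dec v ((v0 + v1) / 2)).
- exists (v + r), (r / 2); repeat split; try lra.
  intros y Hy; apply Rabs_def1; lra.
- exists (v - r), (r / 2); repeat split; try lra.
  intros y Hy; apply Rabs_def1; lra.
Qed.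

(** If midpoint convexity failed at [v], it would fail with a margin uniformly on
    a neighbourhood of [v] and for all small shifts of [u]; a tooth supported
    there would then lower the functional while staying in the weak
    neighbourhood. *)
Lemma weak_minimum_midpoint (I : R -> Prop) (f u : R -> R) (v0 v1 : R) :
  open I -> (forall x, I x -> 0 < f x) -> (forall x, I x -> continuous f x) ->
  v0 < v1 -> C1_seg v0 v1 u -> (forall v, segment v0 v1 v -> I (u v)) ->
  weak_local_minimum I f v0 v1 u ->
  exists h : R, 0 < h /\ forall v : R, segment v0 v1 v ->
    let p := Derive_seg v0 v1 u v in
    2 * density (f (u v)) p <=
    density (f (u v)) (p + h) + density (f (u v)) (p - h).
Proof.
intros I_open f_pos f_cont lt [u_diff u'_cont] uI (eps & eps_pos & u_min).
(* Both suprema measuring the competitor will be at most [h], and the tooth is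
   no higher than its half-width [d] because [h <= 1]. *)
set (h := Rmin 1 (eps / 4)).
assert (h_pos : 0 < h) by (unfold h; apply Rmin_glb_lt; lra).
assert (h_le1 : h <= 1) by apply Rmin_l.
assert (h_le : h <= eps / 4) by apply Rmin_r.
exists h; split; [exact h_pos|]; intros v vs p.
apply Rnot_lt_le; intros concave.
(* Extensions of [u] and [u'] to the line, agreeing with them on the segment. *)
set (U := fun y => u (clamp v0 v1 y)).
set (P := fun y => Derive_seg v0 v1 u (clamp v0 v1 y)).
assert (du : forall y, segment v0 v1 y ->
          is_derive_seg v0 v1 u y (Derive_seg v0 v1 u y))
  by (intros; apply is_derive_Derive_seg; auto).
assert (cu : continuous_on (segment v0 v1) u).
{ intros y ys; apply (is_derive_seg_continuous _ _ _ _ _ ys (du y ys)). }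
assert (cU : forall y, continuous U y)
  by (intros; apply continuous_clamp_comp; [lra|exact cu]).
assert (cP : forall y, continuous P y)
  by (intros; apply continuous_clamp_comp; [lra|exact u'_cont]).
assert (U_eq : forall y, segment v0 v1 y -> U y = u y)
  by (intros; unfold U; rewrite clamp_id; auto).
assert (P_eq : forall y, segment v0 v1 y -> P y = Derive_seg v0 v1 u y)
  by (intros; unfold P; rewrite clamp_id; auto).
assert (UI : forall y, I (U y)) by (intros; apply uI, clamp_segment; lra).
set (A := density (f (u v)) (p + h)) in *.
set (B := density (f (u v)) (p - h)) in *.
set (C := density (f (u v)) p) in *.
(* The bounds [A] and [B] each lose [eta], and [C], which counts twice, loses it
   twice: the gap [2 * C - (A + B)] must exceed [4 * eta]. *)
set (eta := (2 * C - (A + B)) / 5).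
assert (eta_pos : 0 < eta) by (unfold eta; lra).
(* The pair [(y, t)] stands for the point [y] and the height [t] of the tooth at
   [y]: joint continuity at [(v, 0)] makes the estimates uniform in both. *)
set (V := fun q : R * R => U (fst q) + snd q).
assert (base : V (v, 0) = u v) by (unfold V; simpl; rewrite U_eq by auto; ring).
assert (basep : P v = p) by (apply P_eq, vs).
assert (cV : continuous V (v, 0)).
{ apply (continuous_plus (V := R_NormedModule) (fun q => U (fst q)) snd).
  - apply continuous_comp; [apply continuous_fst|apply cU].
  - apply continuous_snd. }
assert (cg : forall s, continuous (fun q => density (f (V q)) (P (fst q) + s)) (v, 0)).
{ intros s; apply continuous_density.
  - apply continuous_comp; [exact cV|rewrite base; apply f_cont, uI, vs].
  - apply (continuous_plus (V := R_NormedModule) (fun q => P (fst q)) (fun _ => s)).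
    + apply continuous_comp; [apply continuous_fst|apply cP].
    + apply continuous_const.
  - rewrite base; apply f_pos, uI, vs. }
assert (near : locally (v, 0) (fun q =>
   I (V q) /\ density (f (V q)) (P (fst q) + h) < A + eta /\
   density (f (V q)) (P (fst q) + - h) < B + eta /\
   C - eta < density (f (V q)) (P (fst q) + 0))).
{ repeat apply filter_and.
  - apply cV, I_open; rewrite base; apply uI, vs.
  - apply (cg h (fun y => y < A + eta)), open_lt.
    cbv beta; rewrite base; simpl; rewrite basep; fold A; lra.
  - apply (cg (- h) (fun y => y < B + eta)), open_lt.
    cbv beta; rewrite base; simpl; rewrite basep; change (p + - h) with (p - h);
      fold B; lra.
  - apply (cg 0 (fun y => C - eta < y)), open_gt.
    cbv beta; rewrite base; simpl; rewrite basep, Rplus_0_r; fold C; lra. }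
destruct near as [delta near].
destruct (small_centred_interval v0 v1 v (Rmin 1 delta) lt vs)
  as (m & d & [d_pos d_lt] & v0m & mv1 & close).
{ apply Rmin_glb_lt; [lra|apply cond_pos]. }
apply Rmin_Rgt_l in d_lt; destruct d_lt as [d_lt1 d_ltd].
set (z := fun y => h * tooth m d y).
assert (z_bounds : forall y, 0 <= z y <= h * d).
{ intros y; destruct (tooth_bounds m d y ltac:(lra)).
  unfold z; split; [apply Rmult_le_pos; lra|apply Rmult_le_compat_l; lra]. }
assert (hd : h * d <= d) by nra.
assert (hd' : h * d <= h) by nra.
assert (cz : forall y, continuous z y).
{ intros y; apply (continuous_mult (K := R_AbsRing) (fun _ => h) (tooth m d)).
  - apply continuous_const.
  - apply tooth_continuous. }
assert (z_out : forall y, y <= m - d \/ m + d <= y -> z y = 0).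
{ intros y hy; unfold z; rewrite tooth_outside; [ring|].
  unfold Rabs; destruct Rcase_abs; lra. }
assert (z_left : forall y, m - d <= y <= m -> z y = h * (y - (m - d)))
  by (intros; unfold z; rewrite tooth_left; auto).
assert (z_right : forall y, m <= y <= m + d -> z y = h * (m + d - y))
  by (intros; unfold z; rewrite tooth_right; auto).
assert (near_in : forall y t, m - d < y < m + d -> 0 <= t <= h * d ->
  I (U y + t) /\ density (f (U y + t)) (P y + h) < A + eta /\
  density (f (U y + t)) (P y + - h) < B + eta /\
  C - eta < density (f (U y + t)) (P y + 0)).
{ intros y t hy ht; apply (near (y, t)); split; simpl.
  - change (Rabs (y - v) < delta).
    apply Rlt_le_trans with (1 := close y hy), Rmin_r.
  - change (Rabs (t - 0) < delta); rewrite Rminus_0_r, Rabs_pos_eq; lra. }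
assert (WI : forall y, I (U y + z y)).
{ intros y.
  destruct (Rle_lt_dec y (m - d)); [rewrite z_out, Rplus_0_r by auto; apply UI|].
  destruct (Rle_lt_dec (m + d) y); [rewrite z_out, Rplus_0_r by auto; apply UI|].
  apply near_in; auto. }
assert (cW : forall y, continuous (fun y => U y + z y) y).
{ intros y; apply (continuous_plus (V := R_NormedModule) U z); auto. }
assert (cPs : forall s y, continuous (fun y => P y + s) y).
{ intros s y; apply (continuous_plus (V := R_NormedModule) P (fun _ => s)); auto.
  apply continuous_const. }
(* The competitor; its derivative on a piece is that of [u] plus the slope of
   the tooth. *)
set (w := fun y => u y + z y).
assert (dw : forall a b s, v0 <= a -> b <= v1 ->
  (forall x y, segment a b x -> segment a b y -> z y - z x = s * (y - x)) ->
  forall x, segment a b x -> is_derive_seg a b w x (P x + s)).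
{ intros a b s v0a bv1 zs x xs.
  assert (xv : segment v0 v1 x) by (unfold segment in *; lra).
  rewrite P_eq by exact xv.
  apply (is_derive_seg_plus_affine v0 v1 a b u w x _ s v0a bv1 xs (du x xv)).
  intros y ys; unfold w; generalize (zs x y xs ys); lra. }
assert (dw1 := dw v0 (m - d) 0 ltac:(lra) ltac:(lra)
  ltac:(unfold segment; intros; rewrite !z_out by lra; ring)).
assert (dw2 := dw (m - d) m h ltac:(lra) ltac:(lra)
  ltac:(unfold segment; intros; rewrite !z_left by lra; ring)).
assert (dw3 := dw m (m + d) (- h) ltac:(lra) ltac:(lra)
  ltac:(unfold segment; intros; rewrite !z_right by lra; ring)).
assert (dw4 := dw (m + d) v1 0 ltac:(lra) ltac:(lra)
  ltac:(unfold segment; intros; rewrite !z_out by lra; ring)).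
assert (w_pc1 : piecewise_C1_seg v0 v1 w).
{ split.
  - apply (continuous_on_ext (segment v0 v1) (fun y => U y + z y)).
    + intros y ys; unfold w; rewrite U_eq; auto.
    + apply continuous_on_forall; auto.
  - exists 4%nat, (fun i => match i with
                    | 0%nat => v0 | 1%nat => m - d | 2%nat => m
                    | 3%nat => m + d | _ => v1 end).
    split; [reflexivity|split; [reflexivity|split]].
    + intros i hi; do 4 (destruct i as [|i]; [lra|]); lia.
    + intros i hi.
      destruct i as [|[|[|[|i]]]]; [| | | |lia].
      * apply (C1_seg_of_derivative v0 (m - d) w (fun y => P y + 0) ltac:(lra) (cPs 0) dw1).
      * apply (C1_seg_of_derivative (m - d) m w (fun y => P y + h) ltac:(lra) (cPs h) dw2).
      * apply (C1_seg_of_derivative m (m + d) w (fun y => P y + - h) ltac:(lra) (cPs (- h)) dw3).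
      * apply (C1_seg_of_derivative (m + d) v1 w (fun y => P y + 0) ltac:(lra) (cPs 0) dw4). }
assert (w_sup : Rbar_le (sup_dist v0 v1 w u) h).
{ apply Lub_Rbar_correct; intros r (y & ys & ->).
  unfold w; replace (u y + z y - u y) with (z y) by ring.
  rewrite Rabs_pos_eq by apply z_bounds; simpl; generalize (z_bounds y); lra. }
assert (w'_sup : Rbar_le (sup_dist_deriv v0 v1 w u) h).
{ apply Lub_Rbar_correct; intros r (y & ys & exw & exu & ->); simpl.
  apply (is_derive_seg_minus_bound v0 v1 w u y _ _ h lt ys);
    try (apply is_derive_Derive_seg; auto).
  intros y' _; unfold w.
  replace (u y' + z y' - u y' - (u y + z y - u y))
    with (h * (tooth m d y' - tooth m d y)) by (unfold z; ring).
  rewrite Rabs_mult, (Rabs_pos_eq h) by lra.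
  apply Rmult_le_compat_l; [lra|apply tooth_lipschitz]. }
assert (minimal : resistance f v0 v1 w >= resistance f v0 v1 u).
{ apply u_min; auto.
  - intros y ys; unfold w; rewrite <- U_eq; auto.
  - unfold w; rewrite z_out by lra; ring.
  - unfold w; rewrite z_out by lra; ring.
  - apply Rbar_le_lt_trans with (Rbar_plus h h).
    + apply Rbar_plus_le_compat; assumption.
    + simpl; lra. }
(* The competitor has strictly smaller resistance, which is absurd. *)
apply Rge_not_lt in minimal; apply minimal; clear minimal.
assert (w_density : forall a b s y, v0 <= a -> b <= v1 -> a < y < b ->
  (forall x, segment a b x -> is_derive_seg a b w x (P x + s)) ->
  f (w y) ^ 2 / (Derive_seg v0 v1 w y ^ 2 + f (w y) ^ 2) =
  density (f (U y + z y)) (P y + s)).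
{ intros a b s y v0a bv1 hy d'.
  assert (ys : segment v0 v1 y) by (unfold segment; lra).
  rewrite (Derive_seg_eq v0 v1 w y (P y + s) lt ys).
  - rewrite (U_eq y ys); reflexivity.
  - apply (is_derive_seg_interior v0 v1 a b); auto.
    apply d'; unfold segment; lra. }
assert (c_density : forall s y, continuous (fun y => density (f (U y + z y)) (P y + s)) y).
{ intros s y; apply continuous_density; auto.
  apply continuous_comp; [apply cW|auto]. }
assert (u_density : resistance f v0 v1 u = RInt (fun y => density (f (U y)) (P y)) v0 v1).
{ apply RInt_ext; intros y hy; rewrite Rmin_left, Rmax_right in hy by lra.
  assert (ys : segment v0 v1 y) by (unfold segment; lra).
  rewrite U_eq, P_eq by exact ys; reflexivity. }
rewrite u_density.
apply (RInt_tooth_lt _ (fun y => density (f (U y + z y)) (P y + h))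
  (fun y => density (f (U y + z y)) (P y + - h)) _ v0 v1 m d
  (A + eta) (B + eta) (C - eta)); auto.
- intros y; apply continuous_density; auto.
  apply continuous_comp; auto.
- intros y [hy|hy].
  + rewrite (w_density v0 (m - d) 0 y); auto; try lra.
    rewrite z_out, !Rplus_0_r by lra; reflexivity.
  + rewrite (w_density (m + d) v1 0 y); auto; try lra.
    rewrite z_out, !Rplus_0_r by lra; reflexivity.
- intros y hy; apply (w_density (m - d) m h y); auto; lra.
- intros y hy; apply (w_density m (m + d) (- h) y); auto; lra.
- intros y hy; destruct (near_in y (z y) ltac:(lra) (z_bounds y)) as (_ & H & _); lra.
- intros y hy; destruct (near_in y (z y) ltac:(lra) (z_bounds y)) as (_ & _ & H & _); lra.
- intros y hy; destruct (near_in y 0 hy ltac:(nra)) as (_ & _ & _ & H).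
  rewrite !Rplus_0_r in H; lra.
- unfold eta; lra.
Qed.

Theorem proposition3p9 (a b : Rbar) (f : R -> R) (v0 v1 : R) (u : R -> R)
  (f_pos : forall x : R, open_Rbar_interval a b x -> 0 < f x)
  (f_smooth : smooth_on_open (open_Rbar_interval a b) f)
  (v0_lt_v1 : v0 < v1)
  (u_extremal : extremal (open_Rbar_interval a b) f v0 v1 u)
  (u_min : weak_local_minimum (open_Rbar_interval a b) f v0 v1 u) :
  forall v : R, segment v0 v1 v -> 3 * Derive_seg v0 v1 u v ^ 2 > f (u v) ^ 2.
Proof.
destruct u_extremal as (u_smooth & uI & _).
assert (I_open : open (open_Rbar_interval a b))
  by (apply open_and; [apply open_Rbar_gt|apply open_Rbar_lt]).
assert (f_cont : forall x, open_Rbar_interval a b x -> continuous f x).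
{ intros x hx.
  apply (ex_derive_continuous (V := R_NormedModule)), (f_smooth 1%nat x hx). }
assert (u_C1 : C1_seg v0 v1 u).
{ split; [exact (u_smooth 0%nat)|].
  intros v vs; destruct (u_smooth 1%nat v vs) as [l d].
  exact (is_derive_seg_continuous _ _ _ _ _ vs d). }
destruct (weak_minimum_midpoint _ f u v0 v1 I_open f_pos f_cont v0_lt_v1 u_C1 uI u_min)
  as (h & h_pos & midpoint).
intros v vs; apply Rnot_le_gt; intros small.
apply (Rle_not_lt _ _ (midpoint v vs)).
apply density_midpoint_lt; auto.
Qed.
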